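(* Let $n\ge 2$, $t\in\{1,\dots,n\}$ and $k\in\{0,\dots,n\}$. If $G\le\mathcal{S}_n$ is sharply $t$-transitive, then $\delta_n(G)=1/|G|$, $\delta_k(G)=0$ if $t\le k<n$, and $$\delta_k(G)=\frac{1}{k!}\sum_{j=0}^{t-k-1}\frac{(-1)^j}{j!}+\frac{(n-t)!}{k!}\sum_{j=t-k}^{n-k}\frac{(-1)^j}{(n-k-j)!\,j!}\qquad\text{if }0\le k<t.$$
   Context: $\mathcal{S}_n$ is the symmetric group on $[n]=\{1,\dots,n\}$. For $G\le\mathcal{S}_n$, $\delta_k(G)$ is the proportion of elements of $G$ with exactly $k$ fixed points in $[n]$. $G$ is sharply $t$-transitive if it acts regularly on the set of $t$-tuples of pairwise distinct elements of $[n]$. *)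

(* Defs.v *)
From mathcomp Require Import all_boot all_order all_algebra.
From mathcomp Require Import all_fingroup all_solvable.

Set Implicit Arguments.
Unset Strict Implicit.
Unset Printing Implicit Defensive.

Import GRing.Theory.

(* The points 1, .., n are represented by 'I_n = {0, .., n - 1}. *)

Definition acts_regularly (aT : finGroupType) (rT : finType)
    (G : {group aT}) (S : {set rT}) (to : {action aT &-> rT}) : Prop :=
  [transitive G, on S | to] /\ {in S, forall x, ('C_G[x | to] = 1)%g}.

Definition sharply_transitive (n t : nat) (G : {group 'S_n}) : Prop :=
  acts_regularly G (t.-dtuple([set: 'I_n])) ('P * t)%act.

Definition delta (n k : nat) (G : {group 'S_n}) : rat :=
  (#|[set g in G | #|('Fix_'P[g])%g| == k]|%:R / #|G|%:R)%R.

(* Main.v *)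
Require Import Defs.
From mathcomp Require Import all_boot all_order all_algebra.
From mathcomp Require Import all_fingroup all_solvable ring.

Set Implicit Arguments.
Unset Strict Implicit.
Unset Printing Implicit Defensive.

Import GRing.Theory.
Local Open Scope ring_scope.

(** Let F(g) be the number of fixed points of g.  The factorial moment
    sum_g F(g)(F(g) - 1)...(F(g) - j + 1) is the number of pairs of an element
    of G and an injective j-tuple fixed by it.  For j <= t the group is
    transitive on these tuples, so the orbit-counting lemma gives |G|; for
    j >= t only the identity contributes, which gives n!/(n - j)!.  Binomial
    inversion recovers the distribution of F from its factorial moments. *)

Lemma ffactnD (m k j : nat) : (m ^_ (k + j) = m ^_ k * (m - k) ^_ j)%N.
Proof.
elim: j => [|j IHj]; first by rewrite addn0 ffactn0 muln1.
by rewrite addnS !ffactnSr IHj subnDA mulnA.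
Qed.

(** Binomial expansion of [(1 - 1) ^+ m], which is 1 at [m = 0] since [0 ^+ 0 = 1]. *)
Lemma alternating_sum_bin (R : comPzRingType) (m : nat) :
  \sum_(0 <= j < m.+1) (-1) ^+ j * 'C(m, j)%:R = (m == 0)%:R :> R.
Proof.
rewrite -expr0n -[X in _ = X ^+ _](subrr 1) exprBn big_mkord; apply: eq_bigr => i _.
by rewrite !expr1n !mulr1 mulr_natr.
Qed.

Lemma natf_fact_neq0 (F : numFieldType) (m : nat) : m`!%:R != 0 :> F.
Proof. by rewrite Num.Theory.pnatr_eq0 -lt0n fact_gt0. Qed.

(** Binomial inversion, pointwise: [m ^_ (k + j) / (k! j!)] equals ['C(m, k) * 'C(m - k, j)], so the
    sum is ['C(m, k)] times an alternating row sum of Pascal's triangle, which vanishes unless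
    [m = k]. The bound [m <= n] ensures that stopping at [n - k] drops no nonzero term. *)
Lemma indicator_ffact (F : numFieldType) (n k m : nat) : (m <= n)%N ->
  (m == k)%:R = \sum_(0 <= j < (n - k).+1)
      (-1) ^+ j * (m ^_ (k + j))%:R / (k`!%:R * j`!%:R) :> F.
Proof.
move=> le_mn; have [lt_mk | le_km] := ltnP m k.
  rewrite ltn_eqF // big1 // => j _.
  by rewrite ffact_small ?mulr0 ?mul0r // ltn_addr.
pose c : F := 'C(m, k)%:R.
rewrite (eq_bigr (fun j => c * ((-1) ^+ j * 'C(m - k, j)%:R))); last first.
  move=> j _; rewrite ffactnD -!bin_ffact !natrM invfM /c.
  by field; rewrite !natf_fact_neq0.
rewrite -mulr_sumr (big_cat_nat _ (n := (m - k).+1)) ?ltnS ?leq_sub2r //=.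
rewrite [X in _ + X]big_nat_cond [X in _ + X]big1 ?addr0; last first.
  by move=> j /andP[/andP[lt_j _] _]; rewrite bin_small ?mulr0.
rewrite alternating_sum_bin subn_eq0 eqn_leq le_km andbT /c.
case: leqP => [le_mk|_]; last by rewrite mulr0.
by rewrite (@anti_leq m k) ?le_mk // binn mulr1.
Qed.

Section FixedTuples.

Variables (gT : finGroupType) (sT : finType) (to : {action gT &-> sT}).
Implicit Types (S : {set sT}) (a : gT) (G : {group gT}).

Lemma card_dtuple_on S j : #|j.-dtuple(S)| = (#|S| ^_ j)%N.
Proof.
rewrite -card_uniq_tuples; apply: eq_card => u.
by rewrite !inE subset_all andbC.
Qed.

Lemma afix_dtuple S a j :
  ('Fix_(j.-dtuple(S) | to * j)[a] = j.-dtuple('Fix_(S | to)[a]))%g.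
Proof.
apply/setP=> u; rewrite in_setI.
apply/andP/idP => [[/dtuple_onP[u_inj Su] /afix1P ua] | /dtuple_onP[u_inj Fu]].
  apply/dtuple_onP; split=> // i; rewrite in_setI Su; apply/afix1P.
  by rewrite -{2}ua tnth_map.
split.
  by apply/dtuple_onP; split=> // i; have /setIP[] := Fu i.
apply/afix1P/eq_from_tnth => i; rewrite tnth_map.
by have /setIP[_ /afix1P] := Fu i.
Qed.

Lemma ntransitive_ffact_moment G S t j :
    (j <= t)%N -> ntransitive t G S to ->
  (\sum_(a in G) #|'Fix_(S | to)[a]%g| ^_ j = #|G|)%N.
Proof.
move=> le_jt /(ntransitive_weak le_jt) trG.
under eq_bigr => a _ do rewrite -card_dtuple_on -afix_dtuple.
rewrite (Frobenius_Cauchy (atrans_acts trG)).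
have /imsetP[u Su defS] := trG.
(* By transitivity the set of orbits is a singleton, so the orbit count is 1. *)
rewrite (_ : [set _ | x in _] = [set j.-dtuple(S)]) ?cards1 ?mul1n //.
apply/setP=> A; rewrite inE; apply/imsetP/eqP => [[v Sv ->] | ->].
  exact: atransP trG v Sv.
by exists u.
Qed.

End FixedTuples.

Section SharplyTransitive.

Variables (n t : nat) (G : {group 'S_n}).
Hypotheses (le_tn : (t <= n)%N) (trG : sharply_transitive t G).

(** If [g] fixed [t] points, listing them would give an injective [t]-tuple fixed by [g], and the
    stabilizer of such a tuple is trivial. *)
Lemma sharply_transitive_fix_lt g :
  g \in G -> g != 1%g -> (#|'Fix_'P[g]%g| < t)%N.
Proof.
move=> Gg; apply: contraR; rewrite -leqNgt -ffact_gt0 -card_dtuple_on.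
case/card_gt0P=> u Fu; have [_ regG] := trG.
have: u \in 'Fix_(t.-dtuple([set: 'I_n]) | 'P * t)[g]%g.
  by rewrite afix_dtuple setTI.
case/setIP=> /regG C1 /afix1P ug; rewrite -in_set1 -[[set 1%g]]C1 inE Gg /=.
exact/astab1P.
Qed.

Lemma card_fix1 : #|'Fix_'P[1 : 'S_n]%g| = n.
Proof.
rewrite -[RHS]card_ord -cardsT; apply: eq_card => x; rewrite in_setT.
by apply/afix1P; rewrite act1.
Qed.

(** Orbit-stabilizer: with trivial stabilizers, [#|G|] is the number [n ^_ t] of injective
    [t]-tuples. *)
Lemma card_sharply_transitive : (#|G| * (n - t)`! = n`!)%N.
Proof.
have [tr regG] := trG; have /imsetP[u Su defS] := tr.
rewrite -(card_orbit_stab ('P * t) G u) -defS (regG u Su) cards1 muln1.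
by rewrite card_dtuple_on cardsT card_ord ffact_fact.
Qed.

Lemma ffact_moment_le j : (j <= t)%N ->
  (\sum_(g in G) #|'Fix_'P[g]%g| ^_ j = #|G|)%N.
Proof.
move=> le_jt; have [tr _] := trG.
rewrite -(ntransitive_ffact_moment le_jt tr).
by apply: eq_bigr => g _; rewrite setTI.
Qed.

Lemma ffact_moment_ge j : (t <= j)%N ->
  (\sum_(g in G) #|'Fix_'P[g]%g| ^_ j = n ^_ j)%N.
Proof.
move=> le_tj; rewrite (bigD1 1%g) //= card_fix1 big1 ?addn0 // => g /andP[Gg g1].
by rewrite ffact_small // (leq_trans (sharply_transitive_fix_lt Gg g1)).
Qed.

(** Apply [indicator_ffact] to the fixed-point count of each element, which is at most [n], then
    exchange the two sums. *)
Lemma delta_ffact_moments k :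
  delta k G = \sum_(0 <= j < (n - k).+1) (-1) ^+ j / (k`!%:R * j`!%:R)
    * ((\sum_(g in G) #|'Fix_'P[g]%g| ^_ (k + j))%:R / #|G|%:R).
Proof.
have fix_le (g : 'S_n) : (#|'Fix_'P[g]%g| <= n)%N.
  by rewrite -[leqRHS]card_ord max_card.
rewrite /delta -sum1_card natr_sum mulr_suml.
rewrite (eq_bigl (fun g => (g \in G) && (#|'Fix_'P[g]%g| == k))); last first.
  by move=> g; rewrite !inE.
rewrite big_mkcondr /=.
under [RHS]eq_bigr => j _ do rewrite natr_sum mulr_suml mulr_sumr.
rewrite exchange_big /=; apply: eq_bigr => g _.
transitivity ((#|'Fix_'P[g]%g| == k)%:R / #|G|%:R : rat).
  by case: eqP; rewrite ?mul0r.
rewrite (indicator_ffact _ _ (fix_le g)) mulr_suml.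
by apply: eq_bigr => j _; rewrite !mulrA [_ * _%:R / _]mulrAC -!mulrA.
Qed.

End SharplyTransitive.

Theorem theorem3p1 (n t k : nat) (G : {group 'S_n})
    (hn : (2 <= n)%N) (ht : (1 <= t <= n)%N) (hk : (k <= n)%N)
    (hG : sharply_transitive t G) :
  [/\ delta n G = 1 / #|G|%:R,
      (t <= k < n)%N -> delta k G = 0
    & (k < t)%N ->
      delta k G =
        1 / k`!%:R * (\sum_(0 <= j < t - k) (-1) ^+ j / j`!%:R)
        + (n - t)`!%:R / k`!%:R
          * (\sum_(t - k <= j < (n - k).+1)
               (-1) ^+ j / ((n - k - j)`!%:R * j`!%:R))].
Proof.
have /andP[_ le_tn] := ht.
have G0 : #|G|%:R != 0 :> rat by rewrite Num.Theory.pnatr_eq0 -lt0n cardG_gt0.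
split=> [|/andP[le_tk lt_kn]|lt_kt].
- rewrite /delta (_ : [set g in G | _] = [set 1%g]) ?cards1 //.
  apply/setP=> g; rewrite !inE; apply/andP/eqP => [[Gg]|->].
    apply: contraTeq => /(sharply_transitive_fix_lt hG Gg) lt_t.
    by rewrite ltn_eqF // (leq_trans lt_t).
  by rewrite group1 card_fix1.
- rewrite /delta (_ : [set g in G | _] = set0) ?cards0 ?mul0r //.
  apply/setP=> g; rewrite !inE; apply/andP => -[Gg].
  have [->|] := eqVneq g 1%g; first by rewrite card_fix1 gtn_eqF.
  move/(sharply_transitive_fix_lt hG Gg) => lt_t.
  by rewrite ltn_eqF // (leq_trans lt_t).
(* Split where the moment order [k + j] reaches [t]: below, the moment is [#|G|] and cancels the
   denominator; from there on it is [n ^_ (k + j)]. *)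
rewrite delta_ffact_moments (big_cat_nat _ (n := t - k)) //=; last first.
  by rewrite leqW ?leq_sub2r.
rewrite !mulr_sumr; congr (_ + _); apply: eq_big_nat => j /andP[le_j lt_j].
  rewrite (ffact_moment_le hG) ?divff //; last first.
    by rewrite ltnW // -ltn_subRL.
  by rewrite mulr1 invfM mul1r mulrCA mulrA.
rewrite (ffact_moment_ge hG) -?leq_subLR //.
have le_kjn : (k + j <= n)%N by rewrite -leq_subRL.
have fact_neq0 := natf_fact_neq0 rat.
have -> : (n ^_ (k + j))%:R = n`!%:R / (n - k - j)`!%:R :> rat.
  by rewrite -subnDA -(ffact_fact le_kjn) natrM mulfK.
(* Writing [n!] as [#|G| * (n - t)!] cancels [#|G|] and leaves the factor [(n - t)!] of the second
   sum. *)
rewrite -(card_sharply_transitive le_tn hG) natrM.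
by field; rewrite !fact_neq0 G0.
Qed.
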